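(* Let $\gamma$ be a smooth regular curve in $\mathbb{H}^2_+$. Then $\gamma$ is a hyperbolic horo-catenary for $\lambda=0$ if and only if the rotational surface $S_\gamma\subset\mathbb{H}^3$ of spherical type generated by $\gamma$ is minimal in $\mathbb{H}^3$.
   Context: $\mathbb{H}^2$ is the upper half-plane $\{(x,y)\in\mathbb{R}^2:y>0\}$ with the metric $g=\frac{dx^2+dy^2}{y^2}$, and $\mathbb{H}^2_+=\{(x,y)\in\mathbb{H}^2:x>0\}$. For $\lambda\in\mathbb{R}$, the energy of a curve $\gamma=(u,v):[a,b]\to\mathbb{H}^2_+$ is $$\mathcal{E}^{hor}_H[\gamma]=\int_a^b\left(\frac{u}{v}+\lambda\right)\frac{\sqrt{u'^2+v'^2}}{v}\,dt.$$ A hyperbolic horo-catenary is a critical point of $\mathcal{E}^{hor}_H$, i.e. a curve at which the first variation vanishes for all smooth variations in $\mathbb{H}^2_+$ with fixed endpoints (equivalently, $(u,v)$ satisfies both Euler–Lagrange equations of the integrand). $\mathbb{H}^3$ is the upper half-space $\{(x_1,x_2,x_3)\in\mathbb{R}^3:x_3>0\}$ with the metric $\frac{1}{x_3^2}(dx_1^2+dx_2^2+dx_3^2)$, and $\mathbb{H}^2$ is embedded in $\mathbb{H}^3$ by $(x,y)\mapsto(x,0,y)$. For $\gamma(t)=(u(t),v(t))$, the rotational surface of spherical type $S_\gamma$ is obtained by rotating $\gamma$ about the $x_3$-axis, i.e. it is parametrized by $\Phi(t,s)=(u(t)\cos s,u(t)\sin s,v(t))$, $t\in[a,b]$, $s\in\mathbb{R}$.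 Minimal means that the mean curvature of $S_\gamma$ in $\mathbb{H}^3$ vanishes identically. *)

(* Defs.v *)
From Stdlib Require Import Reals.
From Coquelicot Require Import Coquelicot.
Open Scope R_scope.

(* A curve [a,b] -> H^2_+ is a pair of functions R -> R used only near [a,b].
   Smoothness on the closed interval means smoothness on an open interval
   containing it, so that the two-sided [Derive] gives the right derivatives at
   the end points. *)
Definition smooth_on_segment (a b : R) (f : R -> R) : Prop :=
  exists d : R, 0 < d /\
    forall t, a - d < t < b + d -> forall n, ex_derive_n f n t.

Definition smooth_curve (a b : R) (u v : R -> R) : Prop :=
  smooth_on_segment a b u /\ smooth_on_segment a b v.

Definition in_H2plus (a b : R) (u v : R -> R) : Prop :=
  forall t, a <= t <= b -> 0 < u t /\ 0 < v t.

Definition regular_curve (a b : R) (u v : R -> R) : Prop :=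
  forall t, a <= t <= b -> ~ (Derive u t = 0 /\ Derive v t = 0).

Definition horo_energy (lambda a b : R) (u v : R -> R) : R :=
  RInt (fun t => (u t / v t + lambda)
                 * (sqrt (Derive u t ^ 2 + Derive v t ^ 2) / v t)) a b.

(* (U e t, V e t) is the point of parameter t on the varied curve of parameter e;
   [ex_diff_n F n e t] for all n is joint C^oo-smoothness, as it is required on
   the whole open rectangle ]-d,d[ x ]a-d,b+d[. *)
Definition fixed_end_variation (a b : R) (u v : R -> R) (U V : R -> R -> R)
    : Prop :=
  exists d : R, 0 < d /\
    (forall e t, - d < e < d -> a - d < t < b + d ->
       forall n, ex_diff_n U n e t /\ ex_diff_n V n e t) /\
    (forall t, a <= t <= b -> U 0 t = u t /\ V 0 t = v t) /\
    (forall e, - d < e < d ->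
       in_H2plus a b (U e) (V e) /\
       U e a = u a /\ V e a = v a /\ U e b = u b /\ V e b = v b).

Definition horo_catenary (lambda a b : R) (u v : R -> R) : Prop :=
  forall U V : R -> R -> R, fixed_end_variation a b u v U V ->
    is_derive (fun e => horo_energy lambda a b (U e) (V e)) 0 0.

Inductive axis : Set := X1 | X2 | X3.

Definition axis_eq_dec (i j : axis) : {i = j} + {i <> j}.
Proof. decide equality. Defined.

Definition vec3 : Type := axis -> R.

Definition sum3 (f : axis -> R) : R := f X1 + f X2 + f X3.

Definition hyp_metric (p : vec3) (i j : axis) : R :=
  if axis_eq_dec i j then / (p X3) ^ 2 else 0.

Definition hyp_metric_inv (p : vec3) (i j : axis) : R :=
  if axis_eq_dec i j then (p X3) ^ 2 else 0.

Definition hyp_inner (p X Y : vec3) : R :=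
  sum3 (fun i => sum3 (fun j => hyp_metric p i j * X i * Y j)).

Definition set_coord (p : vec3) (l : axis) (x : R) : vec3 :=
  fun m => if axis_eq_dec m l then x else p m.

Definition partial_metric (l : axis) (p : vec3) (i j : axis) : R :=
  Derive (fun x => hyp_metric (set_coord p l x) i j) (p l).

Definition christoffel (p : vec3) (k i j : axis) : R :=
  / 2 * sum3 (fun l => hyp_metric_inv p k l *
    (partial_metric i p j l + partial_metric j p i l - partial_metric l p i j)).

Definition cross (X Y : vec3) : vec3 := fun k =>
  match k with
  | X1 => X X2 * Y X3 - X X3 * Y X2
  | X2 => X X3 * Y X1 - X X1 * Y X3
  | X3 => X X1 * Y X2 - X X2 * Y X1
  end.

Definition surface : Type := R -> R -> vec3.

Definition D_t (F : surface) : surface := fun t s k => Derive (fun x => F x s k) t.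
Definition D_s (F : surface) : surface := fun t s k => Derive (fun x => F t x k) s.

(* The metric being conformal to the Euclidean one, the Euclidean cross product
   of two tangent vectors is orthogonal to both for the hyperbolic metric. *)
Definition unit_normal (F : surface) : surface := fun t s k =>
  let n := cross (D_t F t s) (D_s F t s) in
  n k / sqrt (hyp_inner (F t s) n n).

(* Covariant derivative, at p, of a vector field Y along a curve of velocity X,
   where dY is the ordinary derivative of Y along the curve. *)
Definition cov_deriv (p X Y dY : vec3) : vec3 := fun k =>
  dY k + sum3 (fun i => sum3 (fun j => christoffel p k i j * X i * Y j)).

(* Half the trace of the second fundamental form (e, f, g) with respect to the
   first fundamental form (E, F, G). *)
Definition mean_curvature (S : surface) (t s : R) : R :=
  let p := S t s in
  let St := D_t S t s in
  let Ss := D_s S t s in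
  let N := unit_normal S t s in
  let E := hyp_inner p St St in
  let F := hyp_inner p St Ss in
  let G := hyp_inner p Ss Ss in
  let e := hyp_inner p (cov_deriv p St St (D_t (D_t S) t s)) N in
  let f := hyp_inner p (cov_deriv p St Ss (D_t (D_s S) t s)) N in
  let g := hyp_inner p (cov_deriv p Ss Ss (D_s (D_s S) t s)) N in
  (e * G - 2 * f * F + g * E) / (2 * (E * G - F ^ 2)).

Definition spherical_rotation_surface (u v : R -> R) : surface := fun t s k =>
  match k with
  | X1 => u t * cos s
  | X2 => u t * sin s
  | X3 => v t
  end.

Definition minimal_surface (a b : R) (S : surface) : Prop :=
  forall t s, a <= t <= b -> mean_curvature S t s = 0.

(* Main.v *)
(** Both sides of the equivalence reduce to the vanishing of one function K
    ([horo_curvature]).  With W the Euclidean speed, the Euler-Lagrange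
    expressions of u W / v^2 are proportional to v' K and - u' K, because the
    energy is invariant under reparametrization; on the surface side the mean
    curvature is a nowhere vanishing multiple of K.  Hence K = 0 makes the first
    variation vanish.  Conversely, K is itself smooth, so no bump function is
    needed: the variation in the direction K (t - a) (b - t) (- v', u') keeps the
    end points fixed and has as first variation the integral of
    K^2 (t - a) (b - t) / (v^3 W), which forces K = 0. *)

Require Import Defs.
From Stdlib Require Import Reals Lra Lia.
From Coquelicot Require Import Coquelicot.
Open Scope R_scope.

(** * The function K and the mean curvature of the rotational surface *)

(** With W the Euclidean speed and k = (u' v'' - u'' v') / W^3 the Euclidean curvature, this is -
    W^2 (u v W k + v v' + 2 u u'). All denominators and roots are cleared, so K is a polynomial in
    u, v and their derivatives and inherits their smoothness. *)
Definition horo_curvature (u v : R -> R) (t : R) : R :=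
  u t * v t * (Derive_n u 2 t * Derive v t - Derive u t * Derive_n v 2 t)
  - (Derive u t ^ 2 + Derive v t ^ 2) * (v t * Derive v t + 2 * u t * Derive u t).

Lemma regular_speed_pos (x y : R) : ~ (x = 0 /\ y = 0) -> 0 < x ^ 2 + y ^ 2.
Proof.
  intros H.
  assert (x <> 0 \/ y <> 0) as [Hx | Hy] by lra;
  [ assert (0 < x ^ 2) by (apply pow2_gt_0; assumption); assert (0 <= y ^ 2) by apply pow2_ge_0
  | assert (0 < y ^ 2) by (apply pow2_gt_0; assumption); assert (0 <= x ^ 2) by apply pow2_ge_0 ]; lra.
Qed.

Lemma partial_metric_eq (l : axis) (p : vec3) (i j : axis) :
  p X3 <> 0 ->
  partial_metric l p i j =
    match l with
    | X3 => if axis_eq_dec i j then - 2 / p X3 ^ 3 else 0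
    | _ => 0
    end.
Proof.
  intros Hp; unfold partial_metric, hyp_metric, set_coord.
  destruct (axis_eq_dec i j) as [_ | _]; destruct l;
    cbn [axis_eq_dec axis_rec axis_rect sumbool_rec sumbool_rect];
    try apply Derive_const.
  apply is_derive_unique; auto_derive; [now apply (pow_nonzero _ 2) | now field].
Qed.

(** The parametrization is orthogonal, so the mean curvature is e / (2 E) + g / (2 G). The angle
    drops out of every coefficient by rotational symmetry. *)
Lemma mean_curvature_spherical (u v : R -> R) (t s : R) :
  0 < u t -> 0 < v t -> ~ (Derive u t = 0 /\ Derive v t = 0) ->
  exists c, c <> 0 /\
    mean_curvature (spherical_rotation_surface u v) t s = c * horo_curvature u v t.
Proof.
  intros Hu Hv Hreg.
  pose proof (regular_speed_pos _ _ Hreg) as Hw.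
  set (S := spherical_rotation_surface u v).
  set (u1 := Derive u t) in *; set (v1 := Derive v t) in *.
  set (u2 := Derive_n u 2 t); set (v2 := Derive_n v 2 t).
  assert (HSt : forall t s k, D_t S t s k = match k with
      X1 => Derive u t * cos s | X2 => Derive u t * sin s | X3 => Derive v t end).
  { intros x y []; unfold D_t; simpl; trivial; apply Derive_scal_l. }
  assert (HSs : forall t s k, D_s S t s k = match k with
      X1 => - (u t * sin s) | X2 => u t * cos s | X3 => 0 end).
  { intros x y []; unfold D_s; simpl; [ | | apply Derive_const];
    apply is_derive_unique; auto_derive; trivial; ring. }
  assert (HStt : forall k, D_t (D_t S) t s k = match k with
      X1 => u2 * cos s | X2 => u2 * sin s | X3 => v2 end).
  { intros k; unfold D_t at 1.
    rewrite (Derive_ext _ _ _ (fun x => HSt x s k)).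
    destruct k; trivial; apply (Derive_scal_l (Derive u)). }
  assert (HSss : forall k, D_s (D_s S) t s k = match k with
      X1 => - (u t * cos s) | X2 => - (u t * sin s) | X3 => 0 end).
  { intros k; unfold D_s at 1.
    rewrite (Derive_ext _ _ _ (fun x => HSs t x k)).
    destruct k; [ | | apply Derive_const];
    apply is_derive_unique; auto_derive; trivial; ring. }
  (* Oriented as a rewrite rule for [field], which then eliminates the angle from each
     coefficient. *)
  assert (Hcs : cos s * cos s = 1 - sin s * sin s).
  { pose proof (sin2_cos2 s) as H; unfold Rsqr in H; lra. }
  set (n := cross (D_t S t s) (D_s S t s)).
  assert (Hn : hyp_inner (S t s) n n = u t ^ 2 * (u1 ^ 2 + v1 ^ 2) / v t ^ 2).
  { unfold hyp_inner, sum3, hyp_metric, n, cross; rewrite !HSt, !HSs; simpl.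
    fold u1 v1. field [Hcs]. lra. }
  assert (Hq : 0 < sqrt (hyp_inner (S t s) n n)).
  { apply sqrt_lt_R0; rewrite Hn.
    apply Rdiv_lt_0_compat; [apply Rmult_lt_0_compat |]; trivial; now apply pow_lt. }
  assert (HN : forall k, unit_normal S t s k = n k / sqrt (hyp_inner (S t s) n n)) by trivial.
  (* The length of the normal enters only as a positive factor, so it is kept opaque. *)
  set (q := sqrt _) in *.
  exists (- / (2 * v t * q * (u1 ^ 2 + v1 ^ 2))).
  split.
  { apply Ropp_neq_0_compat, Rinv_neq_0_compat, Rgt_not_eq.
    repeat apply Rmult_lt_0_compat; lra. }
  unfold mean_curvature.
  assert (HE : hyp_inner (S t s) (D_t S t s) (D_t S t s) = (u1 ^ 2 + v1 ^ 2) / v t ^ 2).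
  { unfold hyp_inner, sum3, hyp_metric; rewrite !HSt; simpl; fold u1 v1; field [Hcs]; lra. }
  assert (HF : hyp_inner (S t s) (D_t S t s) (D_s S t s) = 0).
  { unfold hyp_inner, sum3, hyp_metric; rewrite !HSt, !HSs; simpl; fold u1 v1; field [Hcs]; lra. }
  assert (HG : hyp_inner (S t s) (D_s S t s) (D_s S t s) = u t ^ 2 / v t ^ 2).
  { unfold hyp_inner, sum3, hyp_metric; rewrite !HSs; simpl; fold u1 v1; field [Hcs]; lra. }
  assert (HSp : S t s X3 <> 0) by (simpl; lra).
  assert (He : hyp_inner (S t s)
      (cov_deriv (S t s) (D_t S t s) (D_t S t s) (D_t (D_t S) t s)) (unit_normal S t s)
    = u t * (v t * (u1 * v2 - u2 * v1) + u1 * (u1 ^ 2 + v1 ^ 2)) / (v t ^ 3 * q)).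
  { unfold hyp_inner, sum3, hyp_metric, cov_deriv, christoffel, sum3, hyp_metric_inv.
    rewrite !partial_metric_eq by exact HSp; rewrite !HN; unfold n, cross.
    rewrite !HStt, !HSt, !HSs; simpl; fold u1 v1; field [Hcs]; lra. }
  assert (Hg : hyp_inner (S t s)
      (cov_deriv (S t s) (D_s S t s) (D_s S t s) (D_s (D_s S) t s)) (unit_normal S t s)
    = u t ^ 2 * (v t * v1 + u t * u1) / (v t ^ 3 * q)).
  { unfold hyp_inner, sum3, hyp_metric, cov_deriv, christoffel, sum3, hyp_metric_inv.
    rewrite !partial_metric_eq by exact HSp; rewrite !HN; unfold n, cross.
    rewrite !HSss, !HSt, !HSs; simpl; fold u1 v1; field [Hcs]; lra. }
  (* The mixed coefficient f is multiplied by F = 0 and never has to be computed. *)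
  rewrite HE, HF, HG, He, Hg; unfold horo_curvature; fold u1 v1 u2 v2.
  field; lra.
Qed.

(** * Differential of the integrand and pointwise integration by parts *)

(* The [+ 0] is the parameter [lambda = 0] of [horo_energy]. *)
Definition integrand (x y p q : R) : R := (x / y + 0) * (sqrt (p ^ 2 + q ^ 2) / y).

Definition integrand_diff (x y p q dx dy dp dq : R) : R :=
  (dx / y - x * dy / y ^ 2) * (sqrt (p ^ 2 + q ^ 2) / y)
  + x / y * ((p * dp + q * dq) / (sqrt (p ^ 2 + q ^ 2) * y) - sqrt (p ^ 2 + q ^ 2) * dy / y ^ 2).

Lemma is_derive_integrand (x y p q : R -> R) (e dx dy dp dq : R) :
  0 < y e -> 0 < p e ^ 2 + q e ^ 2 ->
  is_derive x e dx -> is_derive y e dy -> is_derive p e dp -> is_derive q e dq ->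
  is_derive (fun z => integrand (x z) (y z) (p z) (q z)) e
    (integrand_diff (x e) (y e) (p e) (q e) dx dy dp dq).
Proof.
  intros Hy Hw Hdx Hdy Hdp Hdq; unfold integrand, integrand_diff.
  pose proof (sqrt_lt_R0 _ Hw) as Hs.
  auto_derive.
  - repeat split; trivial; try (eexists; eassumption); try lra.
  - replace (Derive (fun x0 => x x0) e) with dx by (symmetry; now apply is_derive_unique).
    replace (Derive (fun x0 => y x0) e) with dy by (symmetry; now apply is_derive_unique).
    replace (Derive (fun x0 => p x0) e) with dp by (symmetry; now apply is_derive_unique).
    replace (Derive (fun x0 => q x0) e) with dq by (symmetry; now apply is_derive_unique).
    change (p e * (p e * 1)) with (p e ^ 2); change (q e * (q e * 1)) with (q e ^ 2).
    field; lra.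
Qed.

(** The Euler-Lagrange expressions of u W / v^2 paired with the variation field (phi, psi). Both are
    multiples of K, so only the normal component u' psi - v' phi of the field contributes. *)
Definition first_variation_density (u v phi psi : R -> R) (t : R) : R :=
  horo_curvature u v t * (Derive u t * psi t - Derive v t * phi t)
  / (v t * sqrt (Derive u t ^ 2 + Derive v t ^ 2)) ^ 3.

(** For L = x sqrt (p^2 + q^2) / y^2 the differentiated function is L_p phi + L_q psi. By the
    product rule, the differential of L minus the derivative of this boundary term is the
    Euler-Lagrange density. *)
Lemma is_derive_momentum (u v phi psi : R -> R) (t : R) :
  0 < v t -> 0 < Derive u t ^ 2 + Derive v t ^ 2 ->
  ex_derive u t -> ex_derive v t -> ex_derive (Derive u) t -> ex_derive (Derive v) t ->
  ex_derive phi t -> ex_derive psi t ->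
  is_derive (fun t => u t * (Derive u t * phi t + Derive v t * psi t)
      / (v t ^ 2 * sqrt (Derive u t ^ 2 + Derive v t ^ 2))) t
    (integrand_diff (u t) (v t) (Derive u t) (Derive v t)
       (phi t) (psi t) (Derive phi t) (Derive psi t)
     - first_variation_density u v phi psi t).
Proof.
  intros Hv Hw Hu1 Hv1 Hu2 Hv2 Hphi Hpsi; unfold integrand_diff, first_variation_density, horo_curvature.
  pose proof (sqrt_lt_R0 _ Hw) as Hs.
  pose proof (sqrt_sqrt _ (Rlt_le _ _ Hw)) as Hss.
  change (Derive_n u 2 t) with (Derive (Derive u) t).
  change (Derive_n v 2 t) with (Derive (Derive v) t).
  set (u1 := Derive u) in *; set (v1 := Derive v) in *.
  auto_derive; change (u1 t * (u1 t * 1)) with (u1 t ^ 2); change (v1 t * (v1 t * 1)) with (v1 t ^ 2).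
  - repeat split; trivial; apply Rgt_not_eq.
    repeat apply Rmult_lt_0_compat; trivial; lra.
  - change (Derive (fun x : R => u x) t) with (u1 t).
    change (Derive (fun x : R => v x) t) with (v1 t).
    change (Derive (fun x : R => u1 x) t) with (Derive u1 t).
    change (Derive (fun x : R => v1 x) t) with (Derive v1 t).
    change (Derive (fun x : R => phi x) t) with (Derive phi t).
    change (Derive (fun x : R => psi x) t) with (Derive psi t).
    set (W := sqrt _) in *.
    (* Eliminating u'^2 in favour of W^2 lets [field] treat the square root W as an atom. *)
    assert (Hu1t : u1 t * u1 t = W * W - v1 t * v1 t) by (rewrite Hss; ring).
    field [Hu1t]; lra.
Qed.

(** * Smooth functions on an open interval *)

Definition smooth_in (l r : R) (f : R -> R) : Prop :=
  forall t, l < t < r -> forall n, ex_derive_n f n t.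

Lemma interval_locally (l r t : R) (P : R -> Prop) :
  l < t < r -> (forall x, l < x < r -> P x) -> locally t P.
Proof.
  intros [Hl Hr] HP; apply (locally_interval P t l r); trivial; intros y H1 H2; now apply HP.
Qed.

Lemma smooth_in_derivable (l r : R) (f : R -> R) (t : R) :
  smooth_in l r f -> l < t < r -> ex_derive f t.
Proof. intros Hf Ht; exact (Hf t Ht 1%nat). Qed.

Lemma smooth_in_Derive (l r : R) (f : R -> R) :
  smooth_in l r f -> smooth_in l r (Derive f).
Proof.
  intros Hf t Ht [ | n]; [exact I | simpl].
  apply ex_derive_ext with (Derive_n f (n + 1));
    [ | rewrite PeanoNat.Nat.add_1_r; exact (Hf t Ht (S (S n)))].
  intros x; symmetry; apply (Derive_n_comp f n 1).
Qed.

Lemma ex_derive_n_S (f : R -> R) (n : nat) (t : R) :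
  ex_derive f t -> ex_derive_n (Derive f) n t -> ex_derive_n f (S n) t.
Proof.
  destruct n as [ | n]; trivial; intros _ H.
  apply ex_derive_ext with (Derive_n (Derive f) n); trivial.
  intros x; rewrite (Derive_n_comp f n 1), PeanoNat.Nat.add_1_r; reflexivity.
Qed.

Lemma smooth_in_const (l r c : R) : smooth_in l r (fun _ => c).
Proof.
  intros t _ n; apply ex_derive_n_const.
Qed.

Lemma smooth_in_id (l r : R) : smooth_in l r (fun t => t).
Proof.
  intros t _ [ | n]; [exact I | ]; apply ex_derive_n_S; [apply ex_derive_id | ].
  apply ex_derive_n_ext with (fun _ => 1); [intros; symmetry; apply Derive_id | apply ex_derive_n_const].
Qed.

Lemma smooth_in_plus (l r : R) (f g : R -> R) :
  smooth_in l r f -> smooth_in l r g -> smooth_in l r (fun t => f t + g t).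
Proof.
  intros Hf Hg t Ht n.
  apply ex_derive_n_plus; apply (interval_locally l r); auto.
Qed.

(** The derivative f' g + f g' is again a sum of products of smooth functions, so the induction
    ranges over all f and g. It is strong because the rule for sums asks for every lower order. *)
Lemma smooth_in_mult (l r : R) (f g : R -> R) :
  smooth_in l r f -> smooth_in l r g -> smooth_in l r (fun t => f t * g t).
Proof.
  intros Hf Hg t Ht n; revert f g Hf Hg t Ht.
  induction n as [[ | n] IH] using Wf_nat.lt_wf_ind; intros f g Hf Hg t Ht; [exact I | ].
  apply ex_derive_n_S.
  { apply (ex_derive_mult f g); eapply smooth_in_derivable; eassumption. }
  apply ex_derive_n_ext_loc with (fun x => Derive f x * g x + f x * Derive g x).
  { apply (interval_locally l r); trivial; intros x Hx; symmetry.
    apply Derive_mult; eapply smooth_in_derivable; eassumption. }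
  apply ex_derive_n_plus; apply (interval_locally l r); trivial; intros x Hx k Hk;
    apply IH; trivial; try lia; now apply smooth_in_Derive.
Qed.

Ltac smooth :=
  repeat match goal with
  | |- smooth_in ?l ?r (fun _ => ?c) => apply (smooth_in_const l r c)
  | |- smooth_in ?l ?r (fun x => @?f x + @?g x) => apply (smooth_in_plus l r f g)
  | |- smooth_in ?l ?r (fun x => @?f x * @?g x) => apply (smooth_in_mult l r f g)
  | _ => assumption
  end.

Lemma smooth_in_horo_curvature (l r : R) (u v : R -> R) :
  smooth_in l r u -> smooth_in l r v -> smooth_in l r (horo_curvature u v).
Proof.
  intros Hu Hv.
  pose proof (smooth_in_Derive _ _ _ Hu) as Hu1; pose proof (smooth_in_Derive _ _ _ Hv) as Hv1.
  pose proof (smooth_in_Derive _ _ _ Hu1) as Hu2; pose proof (smooth_in_Derive _ _ _ Hv1) as Hv2.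
  intros t Ht n.
  (* Differences and squares become sums and products, the only operations that [smooth] handles. *)
  apply ex_derive_n_ext with (fun t =>
    u t * v t * (Derive (Derive u) t * Derive v t + (-1) * (Derive u t * Derive (Derive v) t))
    + (-1) * ((Derive u t * Derive u t + Derive v t * Derive v t)
              * (v t * Derive v t + 2 * (u t * Derive u t)))).
  { intros x; unfold horo_curvature.
    change (Derive_n u 2 x) with (Derive (Derive u) x).
    change (Derive_n v 2 x) with (Derive (Derive v) x); ring. }
  revert t Ht n.
  change (smooth_in l r (fun t =>
    u t * v t * (Derive (Derive u) t * Derive v t + (-1) * (Derive u t * Derive (Derive v) t))
    + (-1) * ((Derive u t * Derive u t + Derive v t * Derive v t)
              * (v t * Derive v t + 2 * (u t * Derive u t))))).
  smooth.
Qed.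

(** * Joint smoothness of variations affine in the parameter *)

Lemma ex_derive_continuity_2d_snd (f : R -> R) (e t : R) :
  ex_derive f t -> continuity_2d_pt (fun _ y => f y) e t.
Proof.
  intros Hf; apply (continuity_1d_2d_pt_comp f (fun _ y => y)).
  - now apply continuity_pt_filterlim, (ex_derive_continuous f).
  - apply continuity_2d_pt_id2.
Qed.

Lemma interval_locally_2d (l r e t : R) (P : R -> R -> Prop) :
  l < t < r -> (forall x y, l < y < r -> P x y) -> locally_2d P e t.
Proof.
  intros Ht HP.
  assert (Hd : 0 < Rmin (t - l) (r - t)) by (apply Rmin_glb_lt; lra).
  exists (mkposreal _ Hd); simpl; intros x y _ Hy; apply HP.
  pose proof (Rmin_l (t - l) (r - t)); pose proof (Rmin_r (t - l) (r - t)).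
  apply Rabs_lt_between in Hy; lra.
Qed.

(** The class of functions f y + x g y is stable under both partial derivatives, which replace (f,
    g) by (g, 0) and (f', g'). This drives the induction over all f and g. *)
Lemma ex_diff_n_affine (l r : R) (f g : R -> R) (n : nat) (e t : R) :
  smooth_in l r f -> smooth_in l r g -> l < t < r ->
  ex_diff_n (fun x y => f y + x * g y) n e t.
Proof.
  revert f g e t; induction n as [ | n IH]; intros f g e t Hf Hg Ht.
  all: pose proof (smooth_in_derivable _ _ _ _ Hf Ht) as Hft.
  all: pose proof (smooth_in_derivable _ _ _ _ Hg Ht) as Hgt.
  all: assert (Hc : continuity_2d_pt (fun x y => f y + x * g y) e t)
    by (apply continuity_2d_pt_plus; [ | apply continuity_2d_pt_mult; [apply continuity_2d_pt_id1 | ]];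
        now apply ex_derive_continuity_2d_snd).
  - now split.
  - split; [exact Hc | repeat split].
    + auto_derive; trivial.
    + auto_derive; tauto.
    + apply ex_diff_n_ext_loc with (fun x y => g y + x * 0).
      * apply locally_2d_forall; intros x y; symmetry.
        apply is_derive_unique; auto_derive; trivial; ring.
      * apply (IH g (fun _ => 0)); trivial; apply smooth_in_const.
    + apply ex_diff_n_ext_loc with (fun x y => Derive f y + x * Derive g y).
      * apply (interval_locally_2d l r); trivial; intros x y Hy; symmetry.
        pose proof (smooth_in_derivable _ _ _ _ Hf Hy); pose proof (smooth_in_derivable _ _ _ _ Hg Hy).
        rewrite (Derive_plus f (fun y => x * g y)), Derive_scal; trivial; now apply ex_derive_scal.
      * apply IH; trivial; now apply smooth_in_Derive.
Qed.

(** * Positivity and regularity of two-parameter families *)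

Lemma continuity_2d_pt_snd (f : R -> R -> R) (e t : R) :
  continuity_2d_pt f e t -> continuous (f e) t.
Proof.
  intros Hf; apply continuity_pt_filterlim, continuity_pt_locally; intros eps.
  exact (locally_2d_1d_const_x _ _ _ (Hf eps)).
Qed.

Lemma continuous_segment_pos_min (f : R -> R) (a b : R) :
  a <= b -> (forall t, a <= t <= b -> continuous f t) -> (forall t, a <= t <= b -> 0 < f t) ->
  exists m, 0 < m /\ forall t, a <= t <= b -> m <= f t.
Proof.
  intros Hab Hc Hpos.
  destruct (continuity_ab_min f a b Hab) as [x [Hmin Hx]].
  - intros t Ht; now apply continuity_pt_filterlim, Hc.
  - exists (f x); auto.
Qed.

(** By compactness [f 0] has a positive minimum m on the segment, and uniform continuity keeps [f e]
    within m of [f 0] for small e. *)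
Lemma tube_positive (f : R -> R -> R) (a b : R) :
  a <= b -> (forall t, a <= t <= b -> continuity_2d_pt f 0 t) ->
  (forall t, a <= t <= b -> 0 < f 0 t) ->
  exists d, 0 < d /\ forall e t, - d < e < d -> a <= t <= b -> 0 < f e t.
Proof.
  intros Hab Hc Hpos.
  destruct (continuous_segment_pos_min (f 0) a b Hab) as [m [Hm Hmin]]; trivial.
  { intros t Ht; apply continuity_2d_pt_snd; auto. }
  destruct (uniform_continuity_2d_1d' f a b 0 Hc (mkposreal m Hm)) as [[d Hd] Hu]; simpl in Hu.
  exists d; split; trivial; intros e t He Ht.
  assert (H : Rabs (f e t - f 0 t) < m).
  { apply Hu; try lra. unfold Rminus; rewrite Rplus_opp_r, Rabs_R0; lra. }
  specialize (Hmin t Ht); apply Rabs_lt_between in H; lra.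
Qed.

Definition partial1 (F : R -> R -> R) (x y : R) : R := Derive (fun z => F z y) x.
Definition partial2 (F : R -> R -> R) (x y : R) : R := Derive (F x) y.

(** What the first variation formula takes from a smooth family. Digits in the field names list the
    differentiations in order: 1 for the variation parameter, 2 for the curve parameter. *)
Record regularity (F : R -> R -> R) (e t : R) : Prop := {
  reg_cont : continuity_2d_pt F e t;
  reg_cont1 : continuity_2d_pt (partial1 F) e t;
  reg_cont2 : continuity_2d_pt (partial2 F) e t;
  reg_cont21 : continuity_2d_pt (partial1 (partial2 F)) e t;
  reg_der1 : is_derive (fun z => F z t) e (partial1 F e t);
  reg_der21 : is_derive (fun z => partial2 F z t) e (partial1 (partial2 F) e t);
  reg_ex2 : ex_derive (F e) t;
  reg_ex22 : ex_derive (Derive (F e)) t;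
  reg_ex222 : ex_derive (Derive (Derive (F e))) t;
  reg_ex12 : ex_derive (partial1 F e) t;
  reg_schwarz : Derive (partial1 F e) t = partial1 (partial2 F) e t
}.

(** The third order yields [reg_ex222], from which the density, containing second derivatives, is
    continuous. A whole neighbourhood is assumed because Schwarz's theorem asks for the partial
    derivatives around the point. *)
Lemma ex_diff_regularity (F : R -> R -> R) (e t : R) :
  locally_2d (ex_diff_n F 3) e t -> regularity F e t.
Proof.
  intros HF.
  pose proof (locally_2d_singleton _ _ _ HF) as (C & E1 & E2 & D1 & D2).
  destruct D1 as (C1 & E11 & E12 & D11 & D12).
  destruct D2 as (C2 & E21 & E22 & D21 & D22).
  destruct D12 as (C12 & _); destruct D21 as (C21 & _).
  destruct D22 as (_ & _ & E222 & _).
  constructor; trivial; try (now apply Derive_correct).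
  symmetry; apply Schwarz; trivial.
  revert HF; apply locally_2d_impl, locally_2d_forall.
  intros x y (_ & F1 & F2 & (_ & _ & F12 & _) & (_ & F21 & _)); now repeat split.
Qed.

Lemma locally_2d_rectangle (e1 e2 l r e t : R) (P : R -> R -> Prop) :
  e1 < e < e2 -> l < t < r ->
  (forall x y, e1 < x < e2 -> l < y < r -> P x y) -> locally_2d P e t.
Proof.
  intros He Ht HP.
  assert (Hd : 0 < Rmin (Rmin (e - e1) (e2 - e)) (Rmin (t - l) (r - t)))
    by (repeat apply Rmin_glb_lt; lra).
  exists (mkposreal _ Hd); simpl; intros x y Hx Hy.
  pose proof (Rmin_l (Rmin (e - e1) (e2 - e)) (Rmin (t - l) (r - t))).
  pose proof (Rmin_r (Rmin (e - e1) (e2 - e)) (Rmin (t - l) (r - t))).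
  pose proof (Rmin_l (e - e1) (e2 - e)); pose proof (Rmin_r (e - e1) (e2 - e)).
  pose proof (Rmin_l (t - l) (r - t)); pose proof (Rmin_r (t - l) (r - t)).
  apply Rabs_lt_between in Hx; apply Rabs_lt_between in Hy; apply HP; lra.
Qed.

Lemma continuity_2d_pt_pow2 (f : R -> R -> R) (e t : R) :
  continuity_2d_pt f e t -> continuity_2d_pt (fun x y => f x y ^ 2) e t.
Proof.
  intros Hf; apply continuity_2d_pt_ext with (fun x y => f x y * f x y); [intros; ring | ].
  now apply continuity_2d_pt_mult.
Qed.

Lemma continuity_2d_pt_div (f g : R -> R -> R) (e t : R) :
  continuity_2d_pt f e t -> continuity_2d_pt g e t -> g e t <> 0 ->
  continuity_2d_pt (fun x y => f x y / g x y) e t.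
Proof.
  intros Hf Hg H; apply continuity_2d_pt_mult; trivial; now apply continuity_2d_pt_inv.
Qed.

Lemma continuity_2d_pt_pos (f : R -> R -> R) (e t : R) :
  continuity_2d_pt f e t -> 0 < f e t -> locally_2d (fun x y => 0 < f x y) e t.
Proof.
  intros Hf H; generalize (Hf (mkposreal _ H)); apply locally_2d_impl, locally_2d_forall.
  simpl; intros x y Hxy; apply Rabs_lt_between in Hxy; lra.
Qed.

Lemma continuity_2d_integrand_diff (x y p q dx dy dp dq : R -> R -> R) (e t : R) :
  0 < y e t -> 0 < p e t ^ 2 + q e t ^ 2 ->
  continuity_2d_pt x e t -> continuity_2d_pt y e t ->
  continuity_2d_pt p e t -> continuity_2d_pt q e t ->
  continuity_2d_pt dx e t -> continuity_2d_pt dy e t ->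
  continuity_2d_pt dp e t -> continuity_2d_pt dq e t ->
  continuity_2d_pt (fun e t => integrand_diff (x e t) (y e t) (p e t) (q e t)
    (dx e t) (dy e t) (dp e t) (dq e t)) e t.
Proof.
  intros Hy Hw Cx Cy Cp Cq Cdx Cdy Cdp Cdq.
  pose proof (sqrt_lt_R0 _ Hw) as Hs.
  assert (Cs : continuity_2d_pt (fun e t => sqrt (p e t ^ 2 + q e t ^ 2)) e t).
  { apply (continuity_1d_2d_pt_comp sqrt (fun e t => p e t ^ 2 + q e t ^ 2)).
    - apply continuity_pt_sqrt; lra.
    - apply continuity_2d_pt_plus; now apply continuity_2d_pt_pow2. }
  unfold integrand_diff.
  repeat first [ assumption | apply continuity_2d_pt_pow2 | apply continuity_2d_pt_minus
    | apply continuity_2d_pt_plus | apply continuity_2d_pt_div | apply continuity_2d_pt_mult ];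
  repeat first [ apply pow_nonzero | apply Rmult_integral_contrapositive_currified | lra ].
Qed.

(** * The first variation formula *)

Lemma first_variation_density_ex_derive (u v phi psi : R -> R) (t : R) :
  0 < v t -> 0 < Derive u t ^ 2 + Derive v t ^ 2 ->
  ex_derive u t -> ex_derive v t -> ex_derive (Derive u) t -> ex_derive (Derive v) t ->
  ex_derive (Derive (Derive u)) t -> ex_derive (Derive (Derive v)) t ->
  ex_derive phi t -> ex_derive psi t ->
  ex_derive (first_variation_density u v phi psi) t.
Proof.
  intros Hv Hw Hu0 Hv0 Hu1 Hv1 Hu2 Hv2 Hphi Hpsi.
  pose proof (sqrt_lt_R0 _ Hw) as Hs.
  unfold first_variation_density, horo_curvature.
  apply ex_derive_ext with (fun t =>
    (u t * v t * (Derive (Derive u) t * Derive v t - Derive u t * Derive (Derive v) t)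
  - (Derive u t ^ 2 + Derive v t ^ 2) * (v t * Derive v t + 2 * u t * Derive u t))
   * (Derive u t * psi t - Derive v t * phi t)
  / (v t * sqrt (Derive u t ^ 2 + Derive v t ^ 2)) ^ 3); [reflexivity | ].
  set (u1 := Derive u) in *; set (v1 := Derive v) in *.
  set (u2 := Derive u1) in *; set (v2 := Derive v1) in *.
  auto_derive; repeat split; trivial.
  apply (pow_nonzero _ 3), Rmult_integral_contrapositive_currified; [lra | apply Rgt_not_eq; exact Hs].
Qed.

(** The energy is differentiated under the integral sign. The result differs from the density by the
    derivative of the boundary term, which vanishes at both fixed ends. *)
Lemma first_variation (a b d : R) (U V : R -> R -> R) :
  a < b -> 0 < d ->
  (forall e t, - d < e < d -> a - d < t < b + d -> ex_diff_n U 3 e t /\ ex_diff_n V 3 e t) ->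
  (forall e, - d < e < d -> in_H2plus a b (U e) (V e) /\
     U e a = U 0 a /\ V e a = V 0 a /\ U e b = U 0 b /\ V e b = V 0 b) ->
  regular_curve a b (U 0) (V 0) ->
  is_derive (fun e => horo_energy 0 a b (U e) (V e)) 0
    (RInt (first_variation_density (U 0) (V 0) (partial1 U 0) (partial1 V 0)) a b).
Proof.
  intros Hab Hd HD Hin Hreg.
  assert (HR : forall e t, - d < e < d -> a - d < t < b + d -> regularity U e t /\ regularity V e t).
  { intros e t He Ht; split; apply ex_diff_regularity;
      apply (locally_2d_rectangle (- d) d (a - d) (b + d)); trivial;
      intros x y Hx Hy; now apply HD. }
  assert (HU : forall e t, - d < e < d -> a <= t <= b -> regularity U e t).
  { intros e t He Ht; apply HR; lra. }
  assert (HV : forall e t, - d < e < d -> a <= t <= b -> regularity V e t).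
  { intros e t He Ht; apply HR; lra. }
  assert (H0 : - d < 0 < d) by lra.
  set (w := fun e t => partial2 U e t ^ 2 + partial2 V e t ^ 2).
  assert (Hpos : forall e t, - d < e < d -> a <= t <= b -> 0 < V e t).
  { intros e t He Ht; now apply (proj1 (Hin e He)). }
  assert (Hw0 : forall t, a <= t <= b -> 0 < w 0 t).
  { intros t Ht; apply regular_speed_pos, Hreg, Ht. }
  assert (Cw : forall e t, - d < e < d -> a <= t <= b -> continuity_2d_pt w e t).
  { intros e t He Ht; apply continuity_2d_pt_plus; apply continuity_2d_pt_pow2, reg_cont2; auto. }
  (* Regularity is assumed for the base curve only. By compactness the nearby curves are regular
     too, so the square root stays differentiable along them. *)
  destruct (tube_positive w a b) as [d' [Hd' Hw]]; auto; try lra.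
  set (g := fun e t => integrand (U e t) (V e t) (partial2 U e t) (partial2 V e t)).
  set (dg := fun e t => integrand_diff (U e t) (V e t) (partial2 U e t) (partial2 V e t)
    (partial1 U e t) (partial1 V e t) (partial1 (partial2 U) e t) (partial1 (partial2 V) e t)).
  assert (Hdg : forall e t, - d < e < d -> a - d < t < b + d -> 0 < V e t -> 0 < w e t ->
    is_derive (fun z => g z t) e (dg e t)).
  { intros e t He Ht Hv Hwet; destruct (HR e t He Ht) as [RU RV].
    apply (is_derive_integrand (fun z => U z t) (fun z => V z t)
      (fun z => partial2 U z t) (fun z => partial2 V z t));
      trivial; first [now apply reg_der1 | now apply reg_der21]. }
  assert (Cdg : forall t, a <= t <= b -> continuity_2d_pt dg 0 t).
  { intros t Ht; pose proof (HU 0 t H0 Ht) as []; pose proof (HV 0 t H0 Ht) as [].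
    apply continuity_2d_integrand_diff; auto. exact (Hw0 t Ht). }
  assert (Hs : locally 0 (fun e => - d < e < d /\ - d' < e < d')).
  { apply filter_and;
    [apply (interval_locally (- d) d) | apply (interval_locally (- d') d')]; auto; lra. }
  set (T := fun t => U 0 t * (Derive (U 0) t * partial1 U 0 t + Derive (V 0) t * partial1 V 0 t)
      / (V 0 t ^ 2 * sqrt (Derive (U 0) t ^ 2 + Derive (V 0) t ^ 2))).
  set (X := first_variation_density (U 0) (V 0) (partial1 U 0) (partial1 V 0)).
  assert (HT : forall t, a <= t <= b -> is_derive T t (dg 0 t - X t)).
  { intros t Ht; pose proof (HU 0 t H0 Ht) as []; pose proof (HV 0 t H0 Ht) as [].
    (* By Schwarz, the variation of the velocity is the t-derivative of the variation field, as the
       integration by parts requires. *)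
    unfold dg; rewrite <- reg_schwarz0, <- reg_schwarz1.
    apply is_derive_momentum; auto. exact (Hw0 t Ht). }
  assert (CX : forall t, a <= t <= b -> continuous X t).
  { intros t Ht; pose proof (HU 0 t H0 Ht) as []; pose proof (HV 0 t H0 Ht) as [].
    apply (ex_derive_continuous X), first_variation_density_ex_derive; auto. exact (Hw0 t Ht). }
  assert (Cdg1 : forall t, a <= t <= b -> continuous (dg 0) t).
  { intros t Ht; apply continuity_2d_pt_snd; auto. }
  (* Where the family is constant in e, the variation field is zero. *)
  assert (Hend : forall (F : R -> R -> R) t,
    (forall e, - d < e < d -> F e t = F 0 t) -> partial1 F 0 t = 0).
  { intros F t HF; unfold partial1; rewrite (Derive_ext_loc _ (fun _ => F 0 t)).
    - apply Derive_const.
    - apply (interval_locally (- d) d); auto. }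
  assert (HTa : T a = 0).
  { unfold T; rewrite (Hend U a), (Hend V a) by (intros; now apply Hin); unfold Rdiv; ring. }
  assert (HTb : T b = 0).
  { unfold T; rewrite (Hend U b), (Hend V b) by (intros; now apply Hin); unfold Rdiv; ring. }
  assert (Hab' : forall t, Rmin a b <= t <= Rmax a b -> a <= t <= b).
  { intros t; rewrite Rmin_left, Rmax_right; lra. }
  assert (Hint : RInt (dg 0) a b = RInt X a b).
  { assert (IX : ex_RInt X a b) by (apply (ex_RInt_continuous X); auto).
    assert (Idg : ex_RInt (dg 0) a b) by (apply (ex_RInt_continuous (dg 0)); auto).
    assert (H : RInt (fun t => minus (dg 0 t) (X t)) a b = minus (T b) (T a)).
    { apply is_RInt_unique, (is_RInt_derive T (fun t => minus (dg 0 t) (X t))); intros t Ht.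
      - now apply HT, Hab'.
      - apply (continuous_minus (dg 0) X); auto. }
    pose proof (eq_trans (eq_sym (RInt_minus (dg 0) X a b Idg IX)) H) as H'.
    rewrite HTa, HTb in H'; unfold minus, plus, opp in H'; simpl in H'; lra. }
  replace (RInt X a b) with (RInt (fun t => Derive (fun e => g e t) 0) a b).
  2: { rewrite <- Hint; apply RInt_ext; intros t Ht; rewrite Rmin_left, Rmax_right in Ht by lra.
       apply is_derive_unique, Hdg; auto; try lra; [apply Hpos | apply Hw0]; lra. }
  apply (is_derive_RInt_param g a b 0).
  - revert Hs; apply filter_imp; intros e [He He'] t Ht; apply Hab' in Ht.
    eexists; apply Hdg; auto; lra.
  - intros t Ht; apply Hab' in Ht.
    (* The e-derivative of [g] is known to equal [dg] only where height and speed are positive and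
       the family is smooth. These conditions hold near (0, t), so continuity transfers. *)
    apply continuity_2d_pt_ext_loc with dg; auto.
    pose proof (continuity_2d_pt_pos _ _ _ (Cw 0 t H0 Ht) (Hw0 t Ht)) as L1.
    pose proof (continuity_2d_pt_pos _ _ _ (reg_cont _ _ _ (HV 0 t H0 Ht)) (Hpos 0 t H0 Ht)) as L2.
    assert (L3 : locally_2d (fun x y => - d < x < d /\ a - d < y < b + d) 0 t).
    { apply (locally_2d_rectangle (- d) d (a - d) (b + d)); auto; lra. }
    generalize (locally_2d_and _ _ _ _ (locally_2d_and _ _ _ _ L1 L2) L3).
    apply locally_2d_impl, locally_2d_forall; intros x y [[Hwxy Hvxy] [Hx Hy]].
    symmetry; apply is_derive_unique, Hdg; auto.
  - revert Hs; apply filter_imp; intros e [He He'].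
    apply (ex_RInt_continuous (g e)); intros t Ht; apply Hab' in Ht.
    pose proof (HU e t He Ht) as []; pose proof (HV e t He Ht) as [].
    apply (ex_derive_continuous (g e)); eexists.
    apply (is_derive_integrand (U e) (V e) (partial2 U e) (partial2 V e)); auto;
      try (now apply Derive_correct); now apply Hw.
Qed.

(** * Vanishing of continuous functions on a segment *)

Lemma continuous_pos_locally (f : R -> R) (t : R) :
  continuous f t -> 0 < f t -> exists d, 0 < d /\ forall x, Rabs (x - t) < d -> 0 < f x.
Proof.
  intros Hf Ht; apply continuity_pt_filterlim in Hf; rewrite continuity_pt_locally in Hf.
  destruct (Hf (mkposreal _ Ht)) as [[d Hd] H]; simpl in H.
  exists d; split; trivial; intros x Hx; specialize (H x Hx).
  apply Rabs_lt_between in H; lra.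
Qed.

Lemma continuous_zero_closure (f : R -> R) (a b : R) :
  a < b -> (forall t, a <= t <= b -> continuous f t) ->
  (forall t, a < t < b -> f t = 0) -> forall t, a <= t <= b -> f t = 0.
Proof.
  intros Hab Hc Hz t Ht.
  (* Squaring treats both signs of [f t] at once. *)
  assert (H : ~ 0 < f t ^ 2).
  { intros Hpos.
    destruct (continuous_pos_locally (fun x => f x * f x) t) as [d [Hd H]].
    { apply (continuous_mult f f); auto. }
    { lra. }
    assert (exists y, a < y < b /\ Rabs (y - t) < d) as [y [Hy Hyt]].
    { pose proof (Rmin_l d (b - a)); pose proof (Rmin_r d (b - a)).
      assert (0 < Rmin d (b - a)) by (apply Rmin_glb_lt; lra).
      (* From either half of the segment, a quarter step towards the other half lands strictly
         inside. *)
      destruct (Rle_lt_dec t ((a + b) / 2)).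
      - exists (t + Rmin d (b - a) / 4); split; [lra | apply Rabs_lt_between; lra].
      - exists (t - Rmin d (b - a) / 4); split; [lra | apply Rabs_lt_between; lra]. }
    specialize (H y Hyt); rewrite (Hz y Hy) in H; lra. }
  destruct (Req_dec (f t) 0) as [ | Hn]; trivial.
  now destruct H; apply pow2_gt_0.
Qed.

(** A positive value persists on a small window around t. The window contributes a positive integral
    that the nonnegative remainder cannot cancel. *)
Lemma RInt_zero_nonneg (f : R -> R) (a b : R) :
  (forall t, a <= t <= b -> continuous f t) -> (forall t, a <= t <= b -> 0 <= f t) ->
  RInt f a b = 0 -> forall t, a < t < b -> f t = 0.
Proof.
  intros Hc Hnn Hint t Ht.
  destruct (Rle_lt_dec (f t) 0) as [Hle | Hpos].
  { apply Rle_antisym; trivial; apply Hnn; lra. }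
  destruct (continuous_pos_locally f t) as [d [Hd H]]; trivial.
  { apply Hc; lra. }
  pose proof (Rmin_l (d / 2) (Rmin (t - a) (b - t))); pose proof (Rmin_r (d / 2) (Rmin (t - a) (b - t))).
  pose proof (Rmin_l (t - a) (b - t)); pose proof (Rmin_r (t - a) (b - t)).
  assert (Hr : 0 < Rmin (d / 2) (Rmin (t - a) (b - t))) by (repeat apply Rmin_glb_lt; lra).
  set (r := Rmin (d / 2) _) in *.
  assert (Hex : forall x y, a <= x -> x <= y -> y <= b -> ex_RInt f x y).
  { intros x y Hx Hxy Hy; apply (ex_RInt_continuous f); intros z.
    rewrite Rmin_left, Rmax_right by trivial; intros Hz; apply Hc; lra. }
  assert (Hge : forall x y, a <= x -> x <= y -> y <= b -> 0 <= RInt f x y).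
  { intros x y Hx Hxy Hy; apply RInt_ge_0; auto; intros z Hz; apply Hnn; lra. }
  assert (Hgt : 0 < RInt f (t - r) (t + r)).
  { apply RInt_gt_0; [lra | | ]; intros x Hx.
    - apply H, Rabs_lt_between; lra.
    - apply Hc; lra. }
  assert (HC1 : plus (RInt f a (t - r)) (RInt f (t - r) b) = RInt f a b)
    by (apply RInt_Chasles; apply Hex; lra).
  assert (HC2 : plus (RInt f (t - r) (t + r)) (RInt f (t + r) b) = RInt f (t - r) b)
    by (apply RInt_Chasles; apply Hex; lra).
  pose proof (Hge a (t - r) ltac:(lra) ltac:(lra) ltac:(lra)).
  pose proof (Hge (t + r) b ltac:(lra) ltac:(lra) ltac:(lra)).
  unfold plus in HC1, HC2; simpl in HC1, HC2; lra.
Qed.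

(** * Vanishing K makes the curve critical *)

Lemma horo_curvature_ext_loc (u v u' v' : R -> R) (t : R) :
  locally t (fun x => u x = u' x) -> locally t (fun x => v x = v' x) ->
  horo_curvature u v t = horo_curvature u' v' t.
Proof.
  intros Hu Hv; unfold horo_curvature.
  rewrite (Derive_n_ext_loc _ _ 2 _ Hu), (Derive_n_ext_loc _ _ 2 _ Hv).
  rewrite (Derive_ext_loc _ _ _ Hu), (Derive_ext_loc _ _ _ Hv).
  now rewrite (locally_singleton _ _ Hu), (locally_singleton _ _ Hv).
Qed.

(* A varied curve [U 0] is only known to agree with [u] on [[a, b]], so the
   two-sided derivatives at the end points are compared by continuity. *)
Lemma Derive_segment_ext (f g : R -> R) (a b : R) :
  a < b -> (forall t, a <= t <= b -> ex_derive (Derive f) t) ->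
  (forall t, a <= t <= b -> ex_derive (Derive g) t) ->
  (forall t, a <= t <= b -> f t = g t) ->
  forall t, a <= t <= b -> Derive f t = Derive g t.
Proof.
  intros Hab Hf Hg Heq t Ht; apply Rminus_diag_uniq.
  apply (continuous_zero_closure (fun t => Derive f t - Derive g t) a b); trivial.
  - intros x Hx; apply (continuous_minus (Derive f) (Derive g));
      now apply (ex_derive_continuous (Derive _)); auto.
  - intros x Hx; apply Rminus_diag_eq, Derive_ext_loc, (interval_locally a b); trivial.
    intros y Hy; apply Heq; lra.
Qed.

Lemma smooth_curve_smooth_in (a b : R) (u v : R -> R) :
  smooth_curve a b u v ->
  exists d, 0 < d /\ smooth_in (a - d) (b + d) u /\ smooth_in (a - d) (b + d) v.
Proof.
  intros [[d [Hd Hu]] [d' [Hd' Hv]]].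
  pose proof (Rmin_l d d'); pose proof (Rmin_r d d').
  exists (Rmin d d'); split; [now apply Rmin_glb_lt | split]; intros t Ht;
    [apply Hu | apply Hv]; lra.
Qed.

Lemma horo_curvature_zero_catenary (a b : R) (u v : R -> R) :
  a < b -> smooth_curve a b u v -> regular_curve a b u v ->
  (forall t, a <= t <= b -> horo_curvature u v t = 0) -> horo_catenary 0 a b u v.
Proof.
  intros Hab Hs Hreg HK U V (d & Hd & HD & H0 & Hend).
  destruct (smooth_curve_smooth_in _ _ _ _ Hs) as (d' & Hd' & Hu & Hv).
  assert (HR : forall t, a <= t <= b -> ex_derive (Derive (U 0)) t /\ ex_derive (Derive (V 0)) t).
  { intros t Ht; split; apply reg_ex22, ex_diff_regularity;
      apply (locally_2d_rectangle (- d) d (a - d) (b + d)); try lra;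
      intros x y Hx Hy; now apply (HD x y Hx Hy 3%nat). }
  assert (HD1 : forall t, a <= t <= b -> Derive (U 0) t = Derive u t /\ Derive (V 0) t = Derive v t).
  { intros t Ht; split; apply (Derive_segment_ext _ _ a b); trivial; intros x Hx;
      try (now apply HR); try (now apply H0);
      eapply smooth_in_derivable; try (apply smooth_in_Derive; eassumption); lra. }
  assert (Hint : RInt (first_variation_density (U 0) (V 0) (partial1 U 0) (partial1 V 0)) a b = 0).
  { rewrite (RInt_ext _ (fun _ => 0)).
    { rewrite RInt_const; apply Rmult_0_r. }
    intros t; rewrite Rmin_left, Rmax_right by lra; intros Ht.
    unfold first_variation_density.
    (* At interior points [U 0] and [V 0] agree with u and v nearby, so K is the same; the integral
       sees interior points only. *)
    rewrite (horo_curvature_ext_loc (U 0) (V 0) u v), HK;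
      [unfold Rdiv; now rewrite !Rmult_0_l | lra | | ];
      apply (interval_locally a b); trivial; intros x Hx; apply H0; lra. }
  (* Only the value of the derivative is replaced, not the base point 0. *)
  rewrite <- Hint at 2; apply (first_variation a b d); trivial.
  - intros e t He Ht; apply (HD e t He Ht 3%nat).
  - intros e He; destruct (Hend e He) as (Hp & -> & -> & -> & ->); split; trivial.
    destruct (H0 a), (H0 b); try lra; auto.
  - intros t Ht; destruct (HD1 t Ht) as [-> ->]; auto.
Qed.

(** * Criticality forces K to vanish *)

Lemma small_perturbation_pos (f g : R -> R) (a b : R) :
  a <= b -> (forall t, a <= t <= b -> continuous f t) -> (forall t, a <= t <= b -> continuous g t) ->
  (forall t, a <= t <= b -> 0 < f t) ->
  exists d, 0 < d /\ forall e t, - d < e < d -> a <= t <= b -> 0 < f t + e * g t.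
Proof.
  intros Hab Cf Cg Hf; apply (tube_positive (fun e t => f t + e * g t)); trivial.
  - intros t Ht; apply continuity_2d_pt_plus;
      [ | apply continuity_2d_pt_mult; [apply continuity_2d_pt_id1 | ]].
    + apply (continuity_1d_2d_pt_comp f (fun _ y => y)); [ | apply continuity_2d_pt_id2].
      now apply continuity_pt_filterlim, Cf.
    + apply (continuity_1d_2d_pt_comp g (fun _ y => y)); [ | apply continuity_2d_pt_id2].
      now apply continuity_pt_filterlim, Cg.
  - intros t Ht; rewrite Rmult_0_l, Rplus_0_r; auto.
Qed.

Lemma catenary_horo_curvature_zero (a b : R) (u v : R -> R) :
  a < b -> smooth_curve a b u v -> in_H2plus a b u v -> regular_curve a b u v ->
  horo_catenary 0 a b u v -> forall t, a <= t <= b -> horo_curvature u v t = 0.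
Proof.
  intros Hab Hs Hp Hreg Hcat.
  destruct (smooth_curve_smooth_in _ _ _ _ Hs) as (d & Hd & Hu & Hv).
  set (l := a - d) in *; set (r := b + d) in *.
  pose proof (smooth_in_horo_curvature _ _ _ _ Hu Hv) as HK.
  pose proof (smooth_in_Derive _ _ _ Hu) as Hu1; pose proof (smooth_in_Derive _ _ _ Hv) as Hv1.
  pose proof (smooth_in_Derive _ _ _ Hu1) as Hu2.
  pose proof (smooth_in_Derive _ _ _ Hv1) as Hv2.
  set (K := horo_curvature u v) in *.
  pose proof (smooth_in_id l r) as Hid.
  (* The field (- v', u') is normal to the curve. Its factor K makes the density nonnegative, and (t
     - a) (b - t) fixes the end points. *)
  set (phi := fun t => (-1) * Derive v t * K t * ((t + - a) * (b + (-1) * t))).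
  set (psi := fun t => Derive u t * K t * ((t + - a) * (b + (-1) * t))).
  assert (Hphi : smooth_in l r phi) by (unfold phi; smooth).
  assert (Hpsi : smooth_in l r psi) by (unfold psi; smooth).
  assert (Hder : forall f, smooth_in l r f -> forall t, a <= t <= b -> ex_derive f t).
  { intros f Hf t Ht; apply (smooth_in_derivable l r); trivial; unfold l, r; lra. }
  assert (Hcont : forall f, smooth_in l r f -> forall t, a <= t <= b -> continuous f t).
  { intros f Hf t Ht; apply (ex_derive_continuous f); auto. }
  destruct (small_perturbation_pos u phi a b) as (du & Hdu & Hupos); auto;
    [lra | now intros; apply Hp | ].
  destruct (small_perturbation_pos v psi a b) as (dv & Hdv & Hvpos); auto;
    [lra | now intros; apply Hp | ].
  set (U := fun e t => u t + e * phi t); set (V := fun e t => v t + e * psi t).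
  (* One bound for three demands: the domain of smoothness, positivity of [U], and positivity of
     [V]. *)
  set (d0 := Rmin d (Rmin du dv)).
  assert (Hd0 : 0 < d0) by (repeat apply Rmin_glb_lt; trivial).
  assert (Hd0' : d0 <= d /\ d0 <= du /\ d0 <= dv).
  { unfold d0; pose proof (Rmin_l d (Rmin du dv)); pose proof (Rmin_r d (Rmin du dv)).
    pose proof (Rmin_l du dv); pose proof (Rmin_r du dv); lra. }
  assert (Hdiff : forall e t, a - d0 < t < b + d0 -> forall n, ex_diff_n U n e t /\ ex_diff_n V n e t).
  { intros e t Ht n; split; apply (ex_diff_n_affine l r); trivial; unfold l, r; lra. }
  assert (HU0 : forall t, U 0 t = u t) by (intros t; unfold U; ring).
  assert (HV0 : forall t, V 0 t = v t) by (intros t; unfold V; ring).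
  assert (Hin : forall e, - d0 < e < d0 -> in_H2plus a b (U e) (V e)).
  { intros e He t Ht; split; [apply Hupos | apply Hvpos]; trivial; lra. }
  assert (Hend : forall e, U e a = u a /\ V e a = v a /\ U e b = u b /\ V e b = v b).
  { intros e; unfold U, V, phi, psi; repeat split; ring. }
  assert (Hfix : fixed_end_variation a b u v U V).
  { exists d0; split; [trivial | split; [ | split]]; auto. }
  pose proof (Hcat U V Hfix) as Hzero.
  assert (Hreg0 : regular_curve a b (U 0) (V 0)).
  { intros t Ht; rewrite (Derive_ext _ _ _ HU0), (Derive_ext _ _ _ HV0); auto. }
  assert (Hfirst : is_derive (fun e => horo_energy 0 a b (U e) (V e)) 0
    (RInt (first_variation_density (U 0) (V 0) (partial1 U 0) (partial1 V 0)) a b)).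
  { apply (first_variation a b d0); auto.
    intros e He; rewrite !HU0, !HV0; auto. }
  (* The same derivative is 0 by criticality and the integral of the density by the formula, so the
     integral vanishes. *)
  apply is_derive_unique in Hzero; apply is_derive_unique in Hfirst.
  rewrite Hzero in Hfirst; symmetry in Hfirst.
  set (X := first_variation_density u v phi psi).
  assert (HX : RInt X a b = 0).
  { rewrite <- Hfirst; apply RInt_ext; intros t _; unfold X, first_variation_density.
    rewrite (horo_curvature_ext_loc (U 0) (V 0) u v) by now apply filter_forall.
    rewrite (Derive_ext _ _ _ HU0), (Derive_ext _ _ _ HV0), HV0.
    replace (partial1 U 0 t) with (phi t); [replace (partial1 V 0 t) with (psi t) | ]; trivial;
      symmetry; apply is_derive_unique; unfold U, V; auto_derive; trivial; ring. }
  assert (Hspeed : forall t, a <= t <= b -> 0 < Derive u t ^ 2 + Derive v t ^ 2).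
  { intros t Ht; apply regular_speed_pos; auto. }
  assert (CX : forall t, a <= t <= b -> continuous X t).
  { intros t Ht; apply (ex_derive_continuous X), first_variation_density_ex_derive; auto.
    now apply Hp. }
  assert (Hden : forall t, a <= t <= b -> 0 < (v t * sqrt (Derive u t ^ 2 + Derive v t ^ 2)) ^ 3).
  { intros t Ht; apply pow_lt, Rmult_lt_0_compat; [now apply Hp | now apply sqrt_lt_R0, Hspeed]. }
  (* For this field u' psi - v' phi equals K (t - a) (b - t) W^2. *)
  assert (HXeq : forall t, X t = K t ^ 2 * ((t - a) * (b - t)) * (Derive u t ^ 2 + Derive v t ^ 2)
      / (v t * sqrt (Derive u t ^ 2 + Derive v t ^ 2)) ^ 3).
  { intros t; unfold X, first_variation_density, Rdiv; f_equal; fold K; unfold phi, psi; ring. }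
  (* The weight (t - a) (b - t) vanishes at the ends, so K = 0 is shown inside and extended by
     continuity. *)
  apply (continuous_zero_closure K a b); auto.
  intros t Ht.
  assert (HXt : X t = 0).
  { apply (RInt_zero_nonneg X a b); trivial.
    intros x Hx; rewrite HXeq; apply Rmult_le_pos; [ | now apply Rlt_le, Rinv_0_lt_compat, Hden].
    apply Rmult_le_pos; [ | now apply Rlt_le, Hspeed].
    apply Rmult_le_pos; [apply pow2_ge_0 | apply Rmult_le_pos; lra]. }
  rewrite HXeq in HXt.
  assert (Ht' : a <= t <= b) by lra.
  apply Rmult_integral in HXt as [HXt | HXt].
  2: { pose proof (Rinv_0_lt_compat _ (Hden t Ht')); lra. }
  apply Rmult_integral in HXt as [HXt | HXt].
  2: { pose proof (Hspeed t Ht'); lra. }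
  apply Rmult_integral in HXt as [HXt | HXt].
  - apply Rmult_integral in HXt; rewrite Rmult_1_r in HXt; tauto.
  - assert (0 < (t - a) * (b - t)) by (apply Rmult_lt_0_compat; lra); lra.
Qed.

Theorem theorem3p9 (a b : R) (u v : R -> R)
  (hab : a < b)
  (hsmooth : smooth_curve a b u v)
  (hplus : in_H2plus a b u v)
  (hreg : regular_curve a b u v) :
  horo_catenary 0 a b u v <->
  minimal_surface a b (spherical_rotation_surface u v).
Proof.
  split.
  - intros Hcat t s Ht; destruct (hplus t Ht) as [Hu Hv].
    destruct (mean_curvature_spherical u v t s Hu Hv (hreg t Ht)) as (c & _ & ->).
    rewrite (catenary_horo_curvature_zero a b u v) by trivial; apply Rmult_0_r.
  - intros Hmin; apply horo_curvature_zero_catenary; trivial.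
    intros t Ht; destruct (hplus t Ht) as [Hu Hv].
    (* The single angle 0 suffices, since K depends on t alone. *)
    destruct (mean_curvature_spherical u v t 0 Hu Hv (hreg t Ht)) as (c & Hc & H).
    rewrite (Hmin t 0 Ht) in H; symmetry in H; apply Rmult_integral in H; tauto.
Qed.
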